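(* Let $\tau=(\rho',t,k,\theta',1,t-1)\in\mathfrak M_k$ be such that $\rho'_a>t>\theta'_b$ for all $a,b$. Let $\rho$ be the permutation obtained by decreasing each entry of $\rho'$ by $t$, and $\theta$ the permutation obtained by decreasing each entry of $\theta'$ by $1$. Then $$N_\tau(x)=\frac{1-x^2N_\rho(x)\widetilde N_\theta(x)}{1-x-x^2\left(N_\rho(x)+\widetilde N_\theta(x)\right)},\qquad\text{where }\widetilde N_\theta(x)=\frac{1}{1-x-x^2N_\theta(x)}.$$
   Context: A permutation $\pi=\pi_1\cdots\pi_n$ is a Motzkin permutation if it avoids the pattern $132$ (no $i<j<k$ with $\pi_i<\pi_k<\pi_j$) and there are no indices $a<b$ with $\pi_a<\pi_b<\pi_{b+1}$; $\mathfrak M_n$ is the set of them. For a permutation $\sigma$, $N_\sigma(x)=\sum_{n\ge0}|\mathfrak M_n(\sigma)|x^n$, where $\mathfrak M_n(\sigma)$ is the set of Motzkin permutations of length $n$ avoiding $\sigma$ classically. Parenthesized lists denote concatenation of sequences. *)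

(* Defs.v *)
From HB Require Import structures.
From mathcomp Require Import all_boot all_order all_algebra.
From mathcomp Require Import boolp.

Set Implicit Arguments.
Unset Strict Implicit.
Unset Printing Implicit Defensive.

Import GRing.Theory.

(* Permutations of length n are written in one-line notation, as the words
   w : seq nat with perm_eq w (iota 1 n). *)

Definition order_isomorphic (u v : seq nat) : bool :=
  (size u == size v) &&
  [forall i : 'I_(size u), forall j : 'I_(size u),
     (nth 0 u i < nth 0 u j) == (nth 0 v i < nth 0 v j)].

(* The masks m run through all choices of positions in w.  Every word, even
   the empty one, contains the empty pattern. *)
Definition contains (w sigma : seq nat) : bool :=
  [exists m : (size w).-tuple bool, order_isomorphic (mask m w) sigma].

Definition avoids (w sigma : seq nat) : bool := ~~ contains w sigma.

Definition has_motzkin_ascent (w : seq nat) : bool :=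
  [exists a : 'I_(size w), exists b : 'I_(size w),
     [&& a < b, b.+1 < size w,
         nth 0 w a < nth 0 w b & nth 0 w b < nth 0 w b.+1]].

Definition motzkin_perm (w : seq nat) : bool :=
  avoids w [:: 1; 3; 2] && ~~ has_motzkin_ascent w.

(* [permutations] is duplicate-free, so the size of each of the two lists
   below is the cardinality of the set it enumerates. *)
Definition motzkin_perms (n : nat) : seq (seq nat) :=
  [seq w <- permutations (iota 1 n) | motzkin_perm w].

Definition motzkin_avoiders (n : nat) (sigma : seq nat) : seq (seq nat) :=
  [seq w <- motzkin_perms n | avoids w sigma].

(* Formal power series Q[[x]], wrapped in a record so that the Cauchy product
   is not confused with the pointwise structure on functions nat -> rat. *)

Local Open Scope ring_scope.

Record fps := FPS { coef_fps : nat -> rat }.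

Lemma fpsP (f g : fps) : coef_fps f =1 coef_fps g -> f = g.
Proof. by case: f g => [f] [g] /= /funext ->. Qed.

HB.instance Definition _ := gen_eqMixin fps.
HB.instance Definition _ := gen_choiceMixin fps.

Definition fps0 := FPS (fun=> 0).
Definition fps1 := FPS (fun n => (n == 0%N)%:R).
Definition fpsX := FPS (fun n => (n == 1%N)%:R).
Definition fps_opp f := FPS (fun n => - coef_fps f n).
Definition fps_add f g := FPS (fun n => coef_fps f n + coef_fps g n).
Definition fps_mul f g :=
  FPS (fun n => \sum_(i < n.+1) coef_fps f i * coef_fps g (n - i)).

Lemma fps_addA : associative fps_add.
Proof. by move=> f g h; apply: fpsP => n /=; rewrite addrA. Qed.
Lemma fps_addC : commutative fps_add.
Proof. by move=> f g; apply: fpsP => n /=; rewrite addrC. Qed.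
Lemma fps_add0 : left_id fps0 fps_add.
Proof. by move=> f; apply: fpsP => n /=; rewrite add0r. Qed.
Lemma fps_addN : left_inverse fps0 fps_opp fps_add.
Proof. by move=> f; apply: fpsP => n /=; rewrite addNr. Qed.

HB.instance Definition _ :=
  GRing.isZmodule.Build fps fps_addA fps_addC fps_add0 fps_addN.

Definition fps_trunc (m : nat) (f : fps) : {poly rat} :=
  \poly_(i < m) coef_fps f i.

Lemma coef_fps_trunc m f n : (n < m)%N -> (fps_trunc m f)`_n = coef_fps f n.
Proof. by rewrite coef_poly => ->. Qed.

Lemma coef_fps_mul_trunc m f g n : (n < m)%N ->
  coef_fps (fps_mul f g) n = (fps_trunc m f * fps_trunc m g)`_n.
Proof.
move=> nm; rewrite coefM /=; apply: eq_bigr => -[i /=]; rewrite ltnS => le_in _.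
by rewrite !coef_fps_trunc ?(leq_ltn_trans _ nm) // leq_subr.
Qed.

Lemma fps_mulC : commutative fps_mul.
Proof.
by move=> f g; apply: fpsP => n; rewrite !(coef_fps_mul_trunc _ _ (ltnSn n)) mulrC.
Qed.

Lemma fps_mulA : associative fps_mul.
Proof.
move=> f g h; apply: fpsP => n.
pose T := fps_trunc n.+1.
transitivity (T f * (T g * T h))`_n.
  rewrite coefM /=; apply: eq_bigr => -[i /=]; rewrite ltnS => le_in _.
  rewrite coef_fps_trunc ?ltnS //; congr (_ * _).
  by rewrite -coef_fps_mul_trunc ?ltnS ?leq_subr.
rewrite mulrA coefM /=; apply: eq_bigr => -[i /=]; rewrite ltnS => le_in _.
rewrite [(T h)`_ _]coef_fps_trunc ?ltnS ?leq_subr //; congr (_ * _).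
by rewrite -coef_fps_mul_trunc ?ltnS.
Qed.

Lemma fps_mul1 : left_id fps1 fps_mul.
Proof.
move=> f; apply: fpsP => n /=; rewrite big_ord_recl /= mul1r subn0.
by rewrite big1 ?addr0 // => i _; rewrite mul0r.
Qed.

Lemma fps_mulD : left_distributive fps_mul fps_add.
Proof.
move=> f g h; apply: fpsP => n /=; rewrite -big_split /=.
by apply: eq_bigr => i _; rewrite mulrDl.
Qed.

Lemma fps1_neq0 : fps1 != fps0.
Proof. by apply/eqP => -[] /(congr1 (fun f => f 0%N)) /eqP; rewrite oner_eq0. Qed.

HB.instance Definition _ := GRing.Zmodule_isComNzRing.Build fps
  fps_mulA fps_mulC fps_mul1 fps_mulD fps1_neq0.

(* A series is a unit iff its constant coefficient is nonzero; the coefficients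
   of the inverse g of f are determined by solving
   sum_(i <= n) g_i f_(n - i) = [n = 0] for g_n. *)
Fixpoint fps_inv_coefs (f : fps) (n : nat) : seq rat :=
  if n is m.+1 then
    let s := fps_inv_coefs f m in
    rcons s ((coef_fps f 0)^-1 *
             ((m == 0%N)%:R - \sum_(i < m) s`_i * coef_fps f (m - i)))
  else [::].

Definition fps_unit : pred fps := fun f => coef_fps f 0 != 0.

(* The value on non-units is the one required by the unit ring interface. *)
Definition fps_inv (f : fps) : fps :=
  if fps_unit f then FPS (fun n => (fps_inv_coefs f n.+1)`_n) else f.

Lemma size_fps_inv_coefs f n : size (fps_inv_coefs f n) = n.
Proof. by elim: n => //= n IHn; rewrite size_rcons IHn. Qed.

Lemma nth_fps_inv_coefs f m n : (n < m)%N ->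
  (fps_inv_coefs f m)`_n = (fps_inv_coefs f n.+1)`_n.
Proof.
elim: m => // m IHm; rewrite ltnS leq_eqVlt => /predU1P[-> //|lt_nm].
by rewrite -IHm //= nth_rcons size_fps_inv_coefs lt_nm.
Qed.

Lemma fps_mulVf : {in fps_unit, left_inverse 1 fps_inv *%R}.
Proof.
move=> f f_unit; have f0 : coef_fps f 0 != 0 by [].
rewrite /fps_inv -[fps_unit f]/(f \in fps_unit) f_unit.
apply: fpsP => n /=; rewrite big_ord_recr /= subnn.
rewrite nth_rcons size_fps_inv_coefs ltnn eqxx mulrAC mulVf // mul1r addrC.
rewrite [X in _ - X + _](eq_bigr _ (fun i _ => congr1 (fun c => c * _)
  (nth_fps_inv_coefs f (ltn_ord i)))).
by rewrite subrK.
Qed.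

Lemma fps_unitPl (f g : fps) : g * f = 1 -> fps_unit f.
Proof.
move=> /(congr1 (fun h => coef_fps h 0)) /=.
rewrite big_ord_recl big_ord0 addr0 /= => gf1; apply/eqP => f0.
by move/eqP: gf1; rewrite f0 mulr0 eq_sym oner_eq0.
Qed.

Lemma fps_inv_out : {in [predC fps_unit], fps_inv =1 id}.
Proof. by move=> f; rewrite inE /fps_inv -[_ \in _]/(fps_unit f) => /negbTE ->. Qed.

HB.instance Definition _ := GRing.ComNzRing_hasMulInverse.Build fps
  fps_mulVf fps_unitPl fps_inv_out.

Definition N_ (sigma : seq nat) : fps :=
  FPS (fun n => (size (motzkin_avoiders n sigma))%:R).

Definition Ntilde (theta : seq nat) : fps :=
  1 / (1 - fpsX - fpsX ^+ 2 * N_ theta).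

(* Main.v *)
Require Import Defs.
From mathcomp Require Import all_boot all_order all_algebra.
From mathcomp Require Import zify ring.

(* A nonempty Motzkin permutation of length n is either (n, b) with b Motzkin, or
   (a, h, n, b) with a > h > b and a, b Motzkin; h is then |b| + 1.  Write
   psi = (theta', 1, t - 1), so that tau = (rho', t, k, psi) and the only way to
   cut tau into two nonempty blocks with the first above the second is
   (rho', t, k) | psi, whereas psi cannot be cut at all.  Hence (a, h, n, b)
   - avoids psi iff a avoids theta and b avoids psi;
   - avoids tau iff a and b avoid tau and moreover a avoids rho or b avoids psi,
   and inclusion-exclusion on the last disjunction yields
     N_psi = 1 + x N_psi + x^2 N_theta N_psi,
     N_tau = 1 + x N_tau + x^2 (N_rho N_tau + N_tau N_psi - N_rho N_psi),
   the first equation saying that N_psi = Ntilde theta. *)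

Set Implicit Arguments.
Unset Strict Implicit.
Unset Printing Implicit Defensive.

Import GRing.Theory.

(** * Order isomorphism and pattern containment *)

Definition same_order (p q : nat * nat) : bool := (p.1 < q.1) == (p.2 < q.2).

(** As a relation between all pairs of zipped entries, order isomorphism inherits the concatenation
    rules of [allrel], from which [order_isomorphic_cat] follows. *)
Lemma order_isomorphicE u v :
  order_isomorphic u v =
  (size u == size v) && all2rel same_order (zip u v).
Proof.
rewrite /order_isomorphic; case: eqP => //= suv.
apply/'forall_forallP/allrelP => [H p q pz qz|H i j].
  have /= := nthP (0, 0) pz; have /= := nthP (0, 0) qz.
  move=> [j jz <-] [i iz <-]; rewrite /same_order !nth_zip //=.
  move: iz jz; rewrite size_zip -suv minnn => iz jz.
  exact: (H (Ordinal iz) (Ordinal jz)).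
have z (l : 'I_(size u)) : (nth 0 u l, nth 0 v l) \in zip u v.
  by rewrite -nth_zip // mem_nth // size_zip -suv minnn.
exact: H (z i) (z j).
Qed.

Lemma order_isomorphic_size u v : order_isomorphic u v -> size u = size v.
Proof. by rewrite order_isomorphicE => /andP[/eqP]. Qed.

Lemma order_isomorphic_cat u1 u2 v1 v2 : size u1 = size v1 ->
  order_isomorphic (u1 ++ u2) (v1 ++ v2) =
  [&& order_isomorphic u1 v1, order_isomorphic u2 v2,
      allrel same_order (zip u1 v1) (zip u2 v2)
    & allrel same_order (zip u2 v2) (zip u1 v1)].
Proof.
move=> s1; rewrite !order_isomorphicE !size_cat s1 eqn_add2l eqxx /= zip_cat //.
rewrite allrel_catl !allrel_catr.
case: (size u2 == size v2); rewrite /= ?andbF //.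
by do 4!case: allrel.
Qed.

Lemma containsP w s :
  reflect (exists2 u, subseq u w & order_isomorphic u s) (contains w s).
Proof.
apply: (iffP existsP) => [[m Hm]|[u /subseqP[m sm ->] H]].
  by exists (mask m w) => //; apply: mask_subseq.
by exists (Tuple (introT eqP sm)).
Qed.

Lemma containsW w w' s : subseq w w' -> contains w s -> contains w' s.
Proof.
by move=> sw /containsP[u uw H]; apply/containsP; exists u; rewrite // (subseq_trans uw).
Qed.

Lemma order_isomorphic_mapl f u v : {in u &, {mono f : x y / x < y}} ->
  order_isomorphic (map f u) v = order_isomorphic u v.
Proof.
move=> fm; rewrite /order_isomorphic size_map; congr (_ && _).
by apply: eq_forallb => i; apply: eq_forallb => j; rewrite !(nth_map 0) // fm ?mem_nth.
Qed.

Lemma order_isomorphicC u v : order_isomorphic u v = order_isomorphic v u.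
Proof.
rewrite /order_isomorphic eq_sym; case: eqP => //= suv.
apply/'forall_forallP/'forall_forallP => H i j; rewrite eq_sym.
  exact: (H (cast_ord suv i) (cast_ord suv j)).
exact: (H (cast_ord (esym suv) i) (cast_ord (esym suv) j)).
Qed.

Lemma contains_mapl f w s : {mono f : x y / x < y} ->
  contains (map f w) s = contains w s.
Proof.
move=> fm; apply/containsP/containsP => -[u uw H].
  case/subseqP: uw H => m sm ->; rewrite -map_mask order_isomorphic_mapl => [H|? ? _ _ //].
  by exists (mask m w) => //; apply: mask_subseq.
by exists (map f u); rewrite ?map_subseq // order_isomorphic_mapl => // ? ? _ _.
Qed.

Lemma contains_mapr f w s : {in s &, {mono f : x y / x < y}} ->
  contains w (map f s) = contains w s.
Proof.
move=> fm; apply: eq_existsb => m.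
by rewrite order_isomorphicC order_isomorphic_mapl // order_isomorphicC.
Qed.

(** * Occurrences in concatenations and next to extreme entries *)

Lemma mem_zipr (s t : seq nat) y : size s = size t -> y \in t ->
  exists2 x, x \in s & (x, y) \in zip s t.
Proof.
move=> st yt; exists (nth 0 s (index y t)); first by rewrite mem_nth // st index_mem.
by rewrite -{2}(nth_index 0 yt) -nth_zip // mem_nth // size_zip st minnn index_mem.
Qed.

Lemma mem_zip (s t : seq nat) p : p \in zip s t -> p.1 \in s /\ p.2 \in t.
Proof.
elim: s t => [|x s IH] [|y t] //=; rewrite !inE => /predU1P[-> /=|/IH[-> ->]].
  by rewrite !eqxx.
by rewrite !orbT.
Qed.

Lemma contains_cat A B s : allrel gtn A B ->
  contains (A ++ B) s <->
  exists s1 s2, [/\ s = s1 ++ s2, allrel gtn s1 s2, contains A s1 & contains B s2].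
Proof.
move=> AB; split=> [/containsP[u /subseqP[m sm ->]]|].
  rewrite -[m](cat_take_drop (size A)) mask_cat; last first.
    by rewrite size_takel // sm size_cat leq_addr.
  set u1 := mask _ A; set u2 := mask _ B => H.
  have := order_isomorphic_size H; rewrite size_cat => su.
  exists (take (size u1) s), (drop (size u1) s); rewrite cat_take_drop.
  have su1 : size u1 = size (take (size u1) s) by rewrite size_takel // -su leq_addr.
  move: H; rewrite -{1}[s](cat_take_drop (size u1)) order_isomorphic_cat //.
  case/and4P=> H1 H2 _ /allrelP H3; split=> //; last 2 first.
  - by apply/containsP; exists u1; rewrite // mask_subseq.
  - by apply/containsP; exists u2; rewrite // mask_subseq.
  apply/allrelP => x y xs ys.
  have [a aA az] := mem_zipr su1 xs.
  have [b bB bz] := mem_zipr (order_isomorphic_size H2) ys.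
  have /eqP /= <- := H3 _ _ bz az.
  by apply: (allrelP AB); [exact: mem_mask aA | exact: mem_mask bB].
case=> s1 [s2 [-> /allrelP s12 /containsP[u1 u1A H1] /containsP[u2 u2B H2]]].
apply/containsP; exists (u1 ++ u2); first exact: cat_subseq.
rewrite order_isomorphic_cat ?H1 ?H2 ?(order_isomorphic_size H1) //=.
have gt p q : p \in zip u1 s1 -> q \in zip u2 s2 -> q.1 < p.1 /\ q.2 < p.2.
  move=> /mem_zip[p1 p2] /mem_zip[q1 q2]; split; last exact: s12.
  by apply: (allrelP AB); [exact: (mem_subseq u1A) | exact: (mem_subseq u2B)].
apply/andP; split; apply/allrelP => p q pz qz; rewrite /same_order.
  have [h1 h2] := gt _ _ pz qz.
  by rewrite (ltnNge p.1) (ltnNge p.2) (ltnW h1) (ltnW h2).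
by have [-> ->] := gt _ _ qz pz.
Qed.

(** If [x] played the role of [y], the entry of [w] playing a larger entry of [s] would exceed the
    maximum [x]. *)
Lemma contains_cons x w y s : all (gtn x) w -> has (ltn y) s ->
  contains (x :: w) (y :: s) = contains w (y :: s).
Proof.
move=> xw /hasP[z zs /= yz]; apply/idP/idP; last by apply: containsW; apply: subseq_cons.
case/containsP=> -[|a u] /=; first by move=> _ /order_isomorphic_size.
case: eqP => [-> uw|_ uw H]; last by apply/containsP; exists (a :: u).
rewrite -cat1s -[y :: s]cat1s order_isomorphic_cat // => /and4P[_ H /allrelP + _].
have [b bu bz] := mem_zipr (order_isomorphic_size H) zs.
move/(_ (x, y) (b, z)); rewrite /= inE eqxx => /(_ isT bz).
have /= bx := allP xw _ (mem_subseq uw bu).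
by rewrite /same_order /= yz ltnNge (ltnW bx).
Qed.

Lemma subseq_rcons2 (u w : seq nat) a x :
  subseq (rcons u a) (rcons w x) =
  (a == x) && subseq u w || subseq (rcons u a) w.
Proof.
rewrite -[LHS]subseq_rev !rev_rcons /=.
rewrite -[subseq u w]subseq_rev -[subseq (rcons u a) w]subseq_rev rev_rcons.
case: eqP => //= _.
case: (subseq (a :: rev u) _)
  (@subseq_trans _ (a :: rev u) (rev u) (rev w) (subseq_cons _ _)) => [-> //|_].
by rewrite orbF.
Qed.

Lemma subseq_belast (u w : seq nat) a x : subseq (rcons u a) (rcons w x) -> subseq u w.
Proof.
rewrite subseq_rcons2 => /orP[/andP[] //|]; apply: subseq_trans.
exact: subseq_rcons.
Qed.

(** An occurrence that uses the final [x] lets it play [y]; the entry [a] of [w] that plays [z] then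
    compares with [x] as [z] does with [y], which the hypothesis forbids. The maximum and minimum
    cases below are the two instances. *)
Lemma contains_rcons x w y s z : z \in s ->
  {in w, forall a, ~~ (same_order (a, z) (x, y) && same_order (x, y) (a, z))} ->
  contains (rcons w x) (rcons s y) = contains w (rcons s y).
Proof.
move=> zs xw; apply/idP/idP; last by apply: containsW; apply: subseq_rcons.
case/containsP=> u; case: (lastP u) => [_ /order_isomorphic_size|{}u a].
  by rewrite size_rcons.
rewrite subseq_rcons2 => /orP[/andP[/eqP-> uw]|uw H]; last by apply/containsP; exists (rcons u a).
move=> H; have := order_isomorphic_size H; rewrite !size_rcons => -[su].
move: H; rewrite -!cats1 order_isomorphic_cat // => /and4P[H _ /allrelP H1 /allrelP H2].
have [b bu bz] := mem_zipr su zs.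
have := xw _ (mem_subseq uw bu).
by rewrite H1 ?H2 //= inE.
Qed.

Lemma contains_rcons_max x w y s : all (gtn x) w -> has (ltn y) s ->
  contains (rcons w x) (rcons s y) = contains w (rcons s y).
Proof.
move=> /allP xw /hasP[z zs /= yz]; apply: (contains_rcons zs) => a /xw /= ax.
by rewrite /same_order /= ax ltnNge (ltnW yz).
Qed.

Lemma contains_rcons_min x w y s : all (ltn x) w -> has (gtn y) s ->
  contains (rcons w x) (rcons s y) = contains w (rcons s y).
Proof.
move=> /allP xw /hasP[z zs /= yz]; apply: (contains_rcons zs) => a /xw /= ax.
by rewrite /same_order /= ax yz ltnNge (ltnW ax).
Qed.

(** Deleting the last two letters of an occurrence leaves a subsequence of [A] that is order
    isomorphic to [r]. Conversely [h] and [n] can be appended, since they enclose [A] just as [t]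
    and [k] enclose [r]. *)
Lemma contains_peak A h n r t k :
  all (ltn h) A -> all (gtn n) A -> h < n ->
  all (ltn t) r -> all (gtn k) r -> t < k ->
  contains (A ++ [:: h; n]) (r ++ [:: t; k]) = contains A r.
Proof.
move=> /allP hA /allP nA hn /allP tr /allP kr tk; apply/containsP/containsP => -[u uA H].
  have su := order_isomorphic_size H; rewrite size_cat /= addn2 in su.
  case: (lastP u) su uA H => [//|v b]; rewrite size_rcons => -[].
  case: (lastP v) => [//|{}v a]; rewrite size_rcons => -[sv].
  rewrite -!cat_rcons !cats0 => /subseq_belast/subseq_belast vA.
  rewrite -!cats1 -!catA order_isomorphic_cat // => /andP[H _].
  by exists v.
exists (u ++ [:: h; n]); first by rewrite cat_subseq.
rewrite order_isomorphic_cat ?(order_isomorphic_size H) // H /=.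
have z p : p \in zip u r -> [/\ h < p.1, p.1 < n, t < p.2 & p.2 < k].
  move=> /mem_zip[/(mem_subseq uA) p1 p2]; split; [exact: hA|exact: nA|exact: tr|exact: kr].
apply/and3P; split.
- rewrite order_isomorphicE /= /allrel /= /same_order /= !ltnn hn tk.
  by rewrite ltnNge (ltnW hn) ltnNge (ltnW tk).
- apply/allrelP => p q /z[h1 h2 h3 h4]; rewrite !inE /same_order.
  case/orP=> /eqP-> /=; last by rewrite h2 h4.
  by rewrite ltnNge (ltnW h1) ltnNge (ltnW h3).
- apply/allrelP => q p + /z[h1 h2 h3 h4]; rewrite !inE /same_order.
  case/orP=> /eqP-> /=; first by rewrite h1 h3.
  by rewrite ltnNge (ltnW h2) ltnNge (ltnW h4).
Qed.

(** * Motzkin ascents *)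

Lemma has_motzkin_ascentP w :
  reflect (exists a b, [/\ a < b, b.+1 < size w, nth 0 w a < nth 0 w b
                         & nth 0 w b < nth 0 w b.+1])
          (has_motzkin_ascent w).
Proof.
apply: (iffP existsP) => [[a /existsP[b /and4P[]]]|[a [b [ab bw ? ?]]]].
  by exists a, b.
exists (Ordinal (ltn_trans ab (ltnW bw))); apply/existsP.
by exists (Ordinal (ltnW bw)); apply/and4P.
Qed.

(** A new ascent must end at the new last letter [c], so its middle entry is [b] and only the
    smaller earlier entry remains to be found. *)
Lemma motzkin_ascent_rcons_rcons w b c :
  has_motzkin_ascent (rcons (rcons w b) c) =
  has_motzkin_ascent (rcons w b) || (b < c) && has (gtn b) w.
Proof.
apply/has_motzkin_ascentP/orP => [[i [j []]]|[/has_motzkin_ascentP|/andP[bc]]].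
- rewrite size_rcons => ij jw; have jb : j < size (rcons w b) by [].
  rewrite !(nth_rcons _ (rcons w b)) jb (ltn_trans ij jb).
  move: jw; rewrite ltnS leq_eqVlt => /predU1P[ej|jw]; last first.
    by rewrite jw => *; left; apply/has_motzkin_ascentP; exists i, j.
  rewrite ej ltnn eqxx; move: ej; rewrite size_rcons => -[ej].
  have iw : i < size w by rewrite -ej.
  rewrite !nth_rcons ej iw ltnn eqxx => ib bc; right; rewrite bc.
  by apply/hasP; exists (nth 0 w i) => //; apply: mem_nth.
- move=> [i [j [ij jw nij njj]]]; exists i, j; rewrite size_rcons.
  have jb := ltnW jw; have ib := ltn_trans ij jb.
  by rewrite !(nth_rcons _ (rcons w b)) jw jb ib; split=> //; apply: ltnW.
move=> /(has_nthP 0)[i iw ib]; exists i, (size w); rewrite !size_rcons.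
by rewrite !nth_rcons !size_rcons iw (ltnS i) (ltnW iw) !ltnn !eqxx (ltnSn (size w)).
Qed.

(** By induction on [B] from the right. The step from [A] to [B] is a descent, and no entry of [A]
    can be the smaller earlier entry for an ascent inside [B]. *)
Lemma has_motzkin_ascent_cat A B : allrel gtn A B ->
  has_motzkin_ascent (A ++ B) = has_motzkin_ascent A || has_motzkin_ascent B.
Proof.
have asc1 x : has_motzkin_ascent [:: x] = false.
  by apply/negbTE/has_motzkin_ascentP => -[? [? []]].
have asc0 : has_motzkin_ascent [::] = false.
  by apply/negbTE/has_motzkin_ascentP => -[? [? []]].
elim/last_ind: B => [|B c IH]; first by rewrite cats0 asc0 orbF.
rewrite -cats1 allrel_catr => /andP[AB /allrelP Ac]; move: IH AB.
case/lastP: B => [|B b] IH AB.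
  rewrite /= asc1 orbF; case/lastP: A Ac {AB IH} => [|A b] Ac; first by rewrite asc0 asc1.
  rewrite cats1 motzkin_ascent_rcons_rcons ltnNge ltnW ?orbF //.
  by apply: Ac; rewrite ?inE ?mem_rcons ?inE ?eqxx.
rewrite cats1 motzkin_ascent_rcons_rcons -!rcons_cat motzkin_ascent_rcons_rcons.
rewrite rcons_cat IH // has_cat -orbA; congr (_ || (_ || (_ && _))).
case: hasP => // -[a aA /= ab].
have := allrelP AB a b aA; rewrite mem_rcons mem_head => /(_ isT) /=.
by rewrite ltnNge ltnW.
Qed.

Lemma has_motzkin_ascent_peak A h n : all (ltn h) A ->
  has_motzkin_ascent (A ++ [:: h; n]) = has_motzkin_ascent A.
Proof.
move=> hA; rewrite -cat_rcons cats1 motzkin_ascent_rcons_rcons.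
rewrite (eq_in_has (a2 := pred0)) ?has_pred0 ?andbF ?orbF; last first.
  by move=> x /(allP hA) /= hx; rewrite ltnNge ltnW.
rewrite -cats1 has_motzkin_ascent_cat ?allrel1r //.
by rewrite -[RHS]orbF; congr (_ || _); apply/has_motzkin_ascentP => -[? [? []]].
Qed.

Lemma has_motzkin_ascent_cons n b : all (gtn n) b ->
  has_motzkin_ascent (n :: b) = has_motzkin_ascent b.
Proof.
move=> nb; rewrite -cat1s has_motzkin_ascent_cat ?allrel1l //.
by case: has_motzkin_ascentP => // -[? [? []]].
Qed.

Lemma has_motzkin_ascent_map f w : {mono f : x y / x < y} ->
  has_motzkin_ascent (map f w) = has_motzkin_ascent w.
Proof.
move=> fm.
have nthf a b : a < b -> b.+1 < size w ->
    ((nth 0 (map f w) a < nth 0 (map f w) b) = (nth 0 w a < nth 0 w b)) *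
    ((nth 0 (map f w) b < nth 0 (map f w) b.+1) = (nth 0 w b < nth 0 w b.+1)).
  by move=> ab bw; rewrite !(nth_map 0) ?fm // ?(ltn_trans ab) // ltnW.
apply/has_motzkin_ascentP/has_motzkin_ascentP => -[a [b []]]; rewrite 1?size_map.
  by move=> ab bw; rewrite !(nthf _ _ ab bw) => ? ?; exists a, b.
by move=> ab bw ? ?; exists a, b; rewrite !(nthf _ _ ab bw).
Qed.

(** * Gluing two permutations around the peak *)

Definition glue (a b : seq nat) : seq nat :=
  [seq (size b).+1 + x | x <- a] ++ [:: (size b).+1; (size a + size b).+2] ++ b.

(** Sorting each block and putting [B] first gives a sorted list, which must be the whole interval;
    cutting it at [size B] identifies the values of each block. *)
Lemma perm_cat_gt m A B :
  allrel gtn A B -> perm_eq (A ++ B) (iota m (size A + size B)) ->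
  perm_eq B (iota m (size B)) /\ perm_eq A (iota (m + size B) (size A)).
Proof.
move=> AB pAB.
have: sort leq B ++ sort leq A = iota m (size B) ++ iota (m + size B) (size A).
  rewrite -iotaD addnC; apply: (sorted_eq leq_trans anti_leq).
  - rewrite sorted_pairwise; last exact: leq_trans.
    rewrite pairwise_cat -!sorted_pairwise ?sort_sorted; try exact: leq_trans; try exact: leq_total.
    rewrite !andbT; apply/allrelP => x y; rewrite !mem_sort => xB yA.
    exact: ltnW (allrelP AB _ _ yA xB).
  - exact: iota_sorted.
  apply: perm_trans pAB; rewrite perm_sym perm_catC.
  by apply: perm_cat; rewrite perm_sym perm_sort.
move/eqP; rewrite eqseq_cat ?size_sort ?size_iota // => /andP[/eqP<- /eqP<-].
by rewrite !(perm_sym _ (sort _ _)) !perm_sort.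
Qed.

Lemma perm_iota_shift h m n s : perm_eq s (iota (h + m) n) ->
  exists2 s', perm_eq s' (iota m n) & s = map (addn h) s'.
Proof.
move=> ps; exists (map (subn^~ h) s).
  rewrite -[iota m n](mapK (f := addn h) (g := subn^~ h)); last by move=> x; rewrite addKn.
  by rewrite -iotaDl; apply: perm_map.
rewrite -map_comp -[LHS]map_id; apply/eq_in_map => x.
rewrite (perm_mem ps) mem_iota /= => /andP[hx _].
by rewrite subnKC // (leq_trans _ hx) // leq_addr.
Qed.

Lemma perm_glue a b :
  perm_eq a (iota 1 (size a)) -> perm_eq b (iota 1 (size b)) ->
  perm_eq (glue a b) (iota 1 (size a + size b).+2).
Proof.
move=> pa pb.
(* In increasing order the values are those of [b], then the entry before the peak, then the raised
   values of [a], then the peak. *)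
have -> : (size a + size b).+2 = size b + (1 + (size a + 1)) by lia.
have := perm_map (addn (size b).+1) pa; rewrite -iotaDl => /permP {}pa.
apply/permP => p; rewrite /glue !iotaD !count_cat {}pa (permP pb) /=.
have -> : 1 + size b + 1 + size a = (size a + size b).+2 by lia.
by rewrite add1n !addn0; ring.
Qed.

Section Glue.
Variables (a b : seq nat).
Hypotheses (pa : perm_eq a (iota 1 (size a))) (pb : perm_eq b (iota 1 (size b))).

Let A := [seq (size b).+1 + x | x <- a].
Let h := (size b).+1.
Let n := (size a + size b).+2.

Lemma glue_blocks : [/\ glue a b = (A ++ [:: h; n]) ++ b, all (ltn h) A, all (gtn n) A, h < n
   & allrel gtn (A ++ [:: h; n]) b].
Proof.
have hA : {in A, forall x, h < x < n}.
  by move=> _ /mapP[x + ->]; rewrite (perm_mem pa) mem_iota /h /n; lia.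
have hn : h < n by rewrite /h /n; lia.
split=> //.
- by rewrite /glue -catA.
- by apply/allP => x /hA /andP[].
- by apply/allP => x /hA /andP[].
apply/allrelP => x y; rewrite mem_cat (perm_mem pb y) mem_iota !inE => + /andP[_ yb].
have yh : y < h by rewrite /h; lia.
case/orP=> [/hA/andP[hx _]|/orP[]/eqP->]; by [apply: ltn_trans hx|rewrite //= (ltn_trans yh)].
Qed.

(** The pattern ends on neither its maximum nor its minimum, so neither the final maximum [n] nor,
    once that is removed, the final minimum [h] can end an occurrence. *)
Lemma contains_glue_left s y : has (ltn y) s -> has (gtn y) s ->
  contains (A ++ [:: h; n]) (rcons s y) = contains a (rcons s y).
Proof.
have [_ hA nA hn _] := glue_blocks => ys sy.
rewrite -cat_rcons cats1 contains_rcons_max ?contains_rcons_min //.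
  by rewrite contains_mapl // => x z; rewrite ltn_add2l.
by rewrite all_rcons nA andbT.
Qed.

Lemma contains_glue_peak r t k :
  all (ltn t) r -> all (gtn k) r -> t < k ->
  contains (A ++ [:: h; n]) (r ++ [:: t; k]) = contains a r.
Proof.
have [_ hA nA hn _] := glue_blocks => tr kr tk.
by rewrite contains_peak // contains_mapl // => x z; rewrite ltn_add2l.
Qed.

(** The hypothesis says that [s] has no cut into a higher and a lower nonempty block, so by
    [contains_cat] an occurrence stays on one side of the glued word. *)
Lemma contains_glue_indec s :
  (forall s1 s2, s = s1 ++ s2 -> allrel gtn s1 s2 -> s1 = [::] \/ s2 = [::]) ->
  contains (glue a b) s = contains (A ++ [:: h; n]) s || contains b s.
Proof.
have [-> _ _ _ Ab] := glue_blocks => Hs.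
apply/idP/orP => [/(contains_cat _ Ab)[s1 [s2 [es gs c1 c2]]]|[]]; last 2 first.
- by apply: containsW; apply: prefix_subseq.
- by apply: containsW; apply: suffix_subseq.
by case: (Hs _ _ es gs) => e; move: c1 c2; rewrite es e ?cats0; [right|left].
Qed.

(** The pattern 132 is indecomposable in this sense and ends on its middle value, so both preceding
    containment lemmas apply to it; ascents split over the blocks too. *)
Lemma motzkin_glue : motzkin_perm (glue a b) = motzkin_perm a && motzkin_perm b.
Proof.
have [eg hA nA hn Ab] := glue_blocks; rewrite /motzkin_perm /avoids.
rewrite contains_glue_indec; last first.
  case=> [|x [|y [|z [|]]]] //= s2; first by left.
  - by move=> [<- <-].
  - by move=> [<- <- <-].
  by move=> [_ _ _ <-]; right.
rewrite (contains_glue_left (s := [:: 1; 3])) //.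
rewrite eg has_motzkin_ascent_cat // has_motzkin_ascent_peak // !negb_or.
by rewrite andbACA has_motzkin_ascent_map // => x z; rewrite ltn_add2l.
Qed.
End Glue.

(** * Decomposition by the position of the maximum *)

Lemma mem_motzkin_perms n w :
  (w \in motzkin_perms n) = perm_eq w (iota 1 n) && motzkin_perm w.
Proof. by rewrite mem_filter mem_permutations andbC. Qed.

Lemma motzkin_permsP n w : w \in motzkin_perms n ->
  size w = n /\ perm_eq w (iota 1 (size w)).
Proof.
by rewrite mem_motzkin_perms => /andP[pw _]; have:= perm_size pw; rewrite size_iota => ->.
Qed.

Lemma motzkin_perm_cons n b : all (gtn n) b ->
  motzkin_perm (n :: b) = motzkin_perm b.
Proof.
by move=> nb; rewrite /motzkin_perm /avoids contains_cons // has_motzkin_ascent_cons.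
Qed.

Lemma motzkin_perms_cons n b :
  (n.+1 :: b \in motzkin_perms n.+1) = (b \in motzkin_perms n).
Proof.
rewrite !mem_motzkin_perms; have -> : iota 1 n.+1 = rcons (iota 1 n) n.+1.
  by rewrite -{1}(addn1 n) iotaD cats1 add1n.
rewrite perm_sym perm_rcons perm_cons perm_sym; case pb: perm_eq => //=.
apply: motzkin_perm_cons; apply/allP => x.
by rewrite (perm_mem pb) mem_iota add1n => /andP[].
Qed.

Lemma motzkin_perms_glueP n w : w \in motzkin_perms n.+1 -> index n.+1 w != 0 ->
  exists a b, [/\ w = glue a b, a \in motzkin_perms (size a),
                  b \in motzkin_perms (size b) & (size a + size b).+1 = n].
Proof.
rewrite mem_motzkin_perms => /andP[pw mw].
have uw : uniq w by rewrite (perm_uniq pw) iota_uniq.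
have lew x : x \in w -> x <= n.+1.
  by rewrite (perm_mem pw) mem_iota => /andP[].
have: n.+1 \in w by rewrite (perm_mem pw) mem_iota add1n ltnSn.
move=> nw; case/splitPr: nw pw mw uw lew => p q.
case/lastP: p => [|p h]; first by rewrite /= eqxx.
move=> pw mw uw lew _.
have sw := perm_size pw; rewrite size_iota size_cat size_rcons /= in sw.
(* An entry [x] before the maximum and a larger [y] after it would form 132 as [x], [n.+1], [y]. *)
have gt : allrel gtn (rcons (rcons p h) n.+1) q.
  apply/allrelP => x y xs yq; rewrite /= ltn_neqAle.
  have xw : x \in rcons p h ++ n.+1 :: q.
    by rewrite -cat_rcons mem_cat xs.
  have yw : y \in rcons p h ++ n.+1 :: q by rewrite -cat_rcons mem_cat yq orbT.
  have yx : y != x.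
    move: uw; rewrite -cat_rcons cat_uniq => /and3P[_ /hasPn/(_ _ yq) + _].
    by apply: contra => /eqP->.
  rewrite yx leqNgt; apply/negP => xy.
  move: mw => /andP[/negP + _]; apply; apply/containsP.
  have xn : x != n.+1 by rewrite neq_ltn (leq_trans xy (lew _ yw)).
  have yn : y < n.+1.
    rewrite ltn_neqAle lew // andbT; apply: contraTneq uw => yn.
    by rewrite cat_uniq /= -yn yq !andbF.
  exists [:: x; n.+1; y].
    rewrite -(cat1s x) cat_subseq ?sub1seq //= ?eqxx ?sub1seq //.
    by move: xs; rewrite mem_rcons inE (negbTE xn).
  rewrite order_isomorphicE /= /allrel /= /same_order /= !ltnn xy yn (leq_trans xy (lew _ yw)).
  by rewrite [y < x]ltnNge (ltnW xy) [n.+1 < y]ltnNge (ltnW yn) [n.+1 < x]ltnNge (lew _ xw).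
(* As [h] is directly followed by the maximum, a smaller entry before it would complete a Motzkin
   ascent. *)
have hp : all (ltn h) p.
  move: mw => /andP[_]; rewrite -cat_rcons has_motzkin_ascent_cat // negb_or.
  rewrite motzkin_ascent_rcons_rcons negb_or negb_and.
  have hn : h < n.+1.
    rewrite ltn_neqAle lew ?mem_cat ?mem_rcons ?mem_head // andbT.
    apply: contraTneq uw => <-.
    by rewrite cat_uniq /= mem_rcons mem_head !andbF.
  rewrite hn /= => /andP[/andP[_ /hasPn hp] _]; apply/allP => x xp.
  have /= := hp _ xp; rewrite -leqNgt /= leq_eqVlt => /predU1P[hx|//].
  by move: uw; rewrite cat_uniq rcons_uniq hx xp.
have sw' : n.+1 = size (rcons (rcons p h) n.+1) + size q.
  by rewrite !size_rcons -sw addnS addSn.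
move: (pw); rewrite -cat_rcons [X in iota _ X]sw' => /(perm_cat_gt gt)[pq].
(* Moving the maximum to the front puts the higher block first, so [perm_cat_gt] can strip off the
   maximum and then separate [p] from [h]. *)
rewrite size_rcons -cats1 perm_catC => pp.
have [|ph _] := @perm_cat_gt (1 + size q) [:: n.+1] (rcons p h) _ pp.
  rewrite allrel1l; apply/allP => x xp; rewrite /= ltn_neqAle lew ?mem_cat ?xp //.
  by rewrite andbT; apply: contraTneq uw => <-; rewrite cat_uniq /= xp !andbF.
rewrite -cats1 size_cat in ph.
have [|+ pp'] := perm_cat_gt _ ph; first by rewrite allrel1r.
move/perm_mem/(_ h); rewrite mem_head inE add1n => /esym/eqP eh.
have [a pa ep] := perm_iota_shift pp'.
have sa : size p = size a by rewrite ep size_map.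
have ew : rcons p h ++ n.+1 :: q = glue a q.
  by rewrite /glue cat_rcons eh -add1n -ep -sa -sw; congr (_ ++ _ :: _ :: _); rewrite addSn addnS.
rewrite sa in pa; move: mw; rewrite ew motzkin_glue // => /andP[ma mq].
exists a, q; rewrite !mem_motzkin_perms pa pq ma mq.
split=> //; first by rewrite cats1 cat_rcons.
by apply/eqP; rewrite -eqSS -sw sa addSn addnS.
Qed.

(** The position of the maximum thus recovers [size a], so the count can be partitioned by it;
    position 0 is left to the words that start with their maximum. *)
Lemma index_glue a b : perm_eq a (iota 1 (size a)) ->
  index (size a + size b).+2 (glue a b) = (size a).+1.
Proof.
move=> pa; have /negbTE nA : (size a + size b).+2 \notin map (addn (size b).+1) a.
  by apply/mapP => -[x]; rewrite (perm_mem pa) mem_iota; lia.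
by rewrite index_cat nA size_map /= eqxx ltn_eqF ?addn1 // !ltnS leq_addl.
Qed.

Lemma glue_inj a b a' b' : size a = size a' -> size b = size b' ->
  glue a b = glue a' b' -> (a, b) = (a', b').
Proof.
rewrite /glue => sa sb /eqP; rewrite eqseq_cat ?size_map //.
rewrite sa sb => /andP[/eqP ea /eqP[eb]].
by rewrite eb (inj_map (@addnI _) ea).
Qed.

Lemma mem_glue a b i j : a \in motzkin_perms i -> b \in motzkin_perms j ->
  glue a b \in motzkin_perms (i + j).+2.
Proof.
rewrite !mem_motzkin_perms => /andP[pa ma] /andP[pb mb].
have [sa sb] := (perm_size pa, perm_size pb); rewrite !size_iota in sa sb.
by rewrite -{}sa -{}sb in pa pb *; rewrite perm_glue // motzkin_glue // ma.
Qed.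

Lemma uniq_motzkin_perms n : uniq (motzkin_perms n).
Proof. by rewrite filter_uniq ?permutations_uniq. Qed.

Lemma perm_motzkin_index0 n :
  perm_eq [seq w <- motzkin_perms n.+1 | index n.+1 w == 0]
          [seq n.+1 :: b | b <- motzkin_perms n].
Proof.
apply: uniq_perm; first by rewrite filter_uniq ?uniq_motzkin_perms.
  by rewrite map_inj_uniq ?uniq_motzkin_perms // => ? ? [].
move=> w; rewrite mem_filter; apply/andP/mapP => [[]|[b mb ->]]; last first.
  by rewrite /= eqxx motzkin_perms_cons.
case: w => [|x b]; first by rewrite mem_motzkin_perms => _ /andP[/perm_size].
by rewrite /=; case: (x =P n.+1) => [-> _|//]; rewrite motzkin_perms_cons; exists b.
Qed.

Lemma perm_motzkin_index n i : i < n ->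
  perm_eq [seq w <- motzkin_perms n.+1 | index n.+1 w == i.+1]
          [seq glue a b | a <- motzkin_perms i, b <- motzkin_perms (n.-1 - i)].
Proof.
(* Since [i < n], the truncated subtractions are genuine: besides the two peak entries, [n.-1]
   letters are shared by [a] and [b]. *)
move=> lt_in; have ni : (i + (n.-1 - i)).+1 = n by lia.
apply: uniq_perm; first by rewrite filter_uniq ?uniq_motzkin_perms.
  apply: allpairs_uniq; rewrite ?uniq_motzkin_perms // => -[a b] [a' b'].
  move=> /allpairsP[[x y] /= [/motzkin_permsP[sx _] /motzkin_permsP[sy _] [-> ->]]].
  move=> /allpairsP[[x' y'] /= [/motzkin_permsP[sx' _] /motzkin_permsP[sy' _] [-> ->]]].
  by apply: glue_inj; rewrite ?sx ?sy.
move=> w; rewrite mem_filter; apply/andP/allpairsP => /= [[/eqP iw mw]|].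
  have [|a [b [ew ma mb sab]]] := motzkin_perms_glueP mw; first by rewrite iw.
  have [_ pa] := motzkin_permsP ma.
  rewrite {}ew -{}sab {lt_in ni mw} in iw *; move: iw; rewrite index_glue // => -[ia].
  by exists (a, b); rewrite /= -ia addKn.
move=> [[a b] /= [ma mb ->]].
have [sa pa] := motzkin_permsP ma; have [sb _] := motzkin_permsP mb.
split; last by rewrite -{1}ni mem_glue.
by rewrite -{1}ni -{1}sa -sb index_glue // sa.
Qed.

Lemma count_motzkin_perms (P : pred (seq nat)) n :
  count P (motzkin_perms n.+1) =
  count (fun b => P (n.+1 :: b)) (motzkin_perms n) +
  \sum_(i < n) \sum_(a <- motzkin_perms i) \sum_(b <- motzkin_perms (n.-1 - i)) P (glue a b).
Proof.
(* [inord] is faithful only below [n.+1]; [idxE] checks that the maximum occurs in each listed word,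
   so its index is in range. *)
pose idx w : 'I_n.+1 := inord (index n.+1 w).
have idxE w (k : 'I_n.+1) : w \in motzkin_perms n.+1 ->
    (idx w == k) = (index n.+1 w == k).
  move=> mw; rewrite -val_eqE /= inordK //.
  have [sw pw] := motzkin_permsP mw.
  by rewrite -[X in _ < X]sw index_mem (perm_mem pw) mem_iota sw add1n ltnSn.
have cnt (k : 'I_n.+1) : \sum_(w <- motzkin_perms n.+1 | P w && (idx w == k)) 1 =
    count P [seq w <- motzkin_perms n.+1 | index n.+1 w == k].
  rewrite sum1_count [RHS]count_filter; apply: eq_in_count => w mw /=.
  by rewrite idxE.
rewrite -sum1_count (partition_big idx predT) //= big_ord_recl.
rewrite cnt (permP (perm_motzkin_index0 n)) count_map; congr (_ + _).
apply: eq_bigr => i _; rewrite cnt (permP (perm_motzkin_index (ltn_ord i))).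
rewrite -sum1_count big_mkcond big_allpairs_dep /=.
by apply: eq_bigr => a _; apply: eq_bigr => b _; case: (P _).
Qed.

(** * Occurrences of psi and tau in glued permutations *)

Lemma contains_catl w s1 s2 : contains w (s1 ++ s2) -> contains w s1.
Proof.
move=> /containsP[u uw H]; apply/containsP; exists (take (size s1) u).
  by apply: subseq_trans uw; apply: take_subseq.
have := order_isomorphic_size H; rewrite size_cat => su.
move: H; rewrite -{1}[u](cat_take_drop (size s1)) order_isomorphic_cat => [/andP[]//|].
by rewrite size_takel // su leq_addr.
Qed.

Lemma contains_catr w s1 s2 : contains w (s1 ++ s2) -> contains w s2.
Proof.
move=> /containsP[u uw H]; apply/containsP; exists (drop (size s1) u).
  by apply: subseq_trans uw; apply: drop_subseq.
have := order_isomorphic_size H; rewrite size_cat => su.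
move: H; rewrite -{1}[u](cat_take_drop (size s1)) order_isomorphic_cat => [/and3P[]//|].
by rewrite size_takel // su leq_addr.
Qed.

Lemma cat_eq_overlap (T : Type) (s1 s2 t1 t2 : seq T) : s1 ++ s2 = t1 ++ t2 ->
  exists r, s1 = t1 ++ r /\ t2 = r ++ s2 \/ t1 = s1 ++ r /\ s2 = r ++ t2.
Proof.
elim: s1 t1 => [|x s1 IH] [|y t1] /=.
- by move=> ->; exists [::]; left.
- by move=> ->; exists (y :: t1); right.
- by move=> <-; exists (x :: s1); left.
by case=> -> /IH[r [[-> ->]|[-> ->]]]; exists r; [left|right].
Qed.

Section Pattern.
Variables (r th : seq nat) (t k m : nat).
Hypotheses (tr : all (ltn t) r) (kr : all (gtn k) r) (tk : t < k).
Hypotheses (th1 : all (ltn 1) th) (thm : all (gtn m) th) (m1 : 1 < m) (mt : m < t).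

(** Here [r], [th] and [m] stand for rho', theta' and t - 1 before any reduction; the shifts are
    handled at the end by [N_map]. *)
Let psi := th ++ [:: 1; m].
Let tau := r ++ [:: t; k] ++ psi.

Let psi_le x : x \in psi -> x <= m.
Proof.
by rewrite mem_cat !inE => /orP[/(allP thm)/ltnW//|/orP[]/eqP->//]; apply: ltnW.
Qed.

(** Because psi ends on its maximum [m], the second part of any cut holds an entry that nothing in
    the first part exceeds. *)
Let psi_last s1 s2 : psi = s1 ++ s2 -> s2 != [::] -> m \in s2.
Proof.
case/lastP: s2 => // s2 z; rewrite /psi -cat_rcons cats1 -rcons_cat => /rcons_inj[_ ->] _.
by rewrite mem_rcons mem_head.
Qed.

Section Glue.
Variables (a b : seq nat).
Hypotheses (pa : perm_eq a (iota 1 (size a))) (pb : perm_eq b (iota 1 (size b))).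

Lemma contains_glue_psi : contains (glue a b) psi = contains a th || contains b psi.
Proof.
rewrite contains_glue_indec // ?contains_glue_peak // => s1 s2 es gs.
case: s1 es gs => [|x s1] es gs; [by left | right; apply/eqP/negP => /negP s2n].
have := allrelP gs x m (mem_head _ _) (psi_last es s2n).
by rewrite /= ltnNge psi_le // es mem_head.
Qed.

Lemma contains_glue_tau :
  contains (glue a b) tau =
  [|| contains a tau, contains b tau | contains a r && contains b psi].
Proof.
have [eg _ _ _ Ab] := glue_blocks pa pb.
set A := _ ++ [:: _; _] in eg Ab.
have cA : contains A tau = contains a tau.
  have -> : tau = rcons (r ++ [:: t; k] ++ th ++ [:: 1]) m.
    by rewrite -cats1 /tau /psi -!catA.
  apply: contains_glue_left => //; apply/hasP; [exists k | exists 1];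
    by rewrite ?mem_cat ?inE ?eqxx ?orbT //= (ltn_trans mt tk).
rewrite eg; apply/idP/or3P => [/(contains_cat _ Ab)[s1 [s2 [es gs c1 c2]]]|].
  case: (s2 =P [::]) => [e|/eqP s2n].
    by constructor 1; rewrite -cA es e cats0.
  case: s1 es gs c1 => [|x s1] es gs c1; first by constructor 2; rewrite es.
  have ex := es; rewrite /tau catA in ex.
  (* The cut of tau is compared with the cut between [k] and psi. A later cut leaves [m], the
     maximum of psi, in the lower part; an earlier one leaves [k] there. Both are impossible, so the
     two cuts coincide. *)
  have [u [[e1 e2]|[e1 e2]]] := cat_eq_overlap (esym ex).
    case: u e1 e2 => [|y u] e1 e2.
      constructor 3; move: c1 c2; rewrite e1 cats0 contains_glue_peak // => ->.
      by rewrite e2.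
    have := allrelP gs y m _ (psi_last e2 s2n); rewrite e1 mem_cat mem_head orbT => /(_ isT).
    by rewrite /= ltnNge psi_le // e2 mem_head.
  case/lastP: u e1 e2 => [|u y] e1 e2.
    constructor 3; move: c1 c2; rewrite e2 -[x :: s1]cats0 -e1 contains_glue_peak //.
    by move=> -> ->.
  have ey : y = k.
    by move: e1; rewrite -rcons_cat -cat_rcons cats1 => /rcons_inj[].
  have := allrelP gs x k (mem_head _ _); rewrite e2 mem_cat mem_rcons ey mem_head.
  move=> /(_ isT) /=; rewrite ltnNge => /negP[].
  have: x \in r ++ [:: t; k] by rewrite e1 mem_head.
  by rewrite mem_cat !inE => /orP[/(allP kr)/ltnW//|/orP[]/eqP->//]; apply: ltnW.
case=> [c|c|/andP[c1 c2]].
- by apply: containsW (prefix_subseq _ _) _; rewrite cA.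
- by apply: containsW (suffix_subseq _ _) _.
apply/(contains_cat _ Ab); exists (r ++ [:: t; k]), psi; split=> //.
- by rewrite /tau catA.
- apply/allrelP => x y; rewrite mem_cat => xr /psi_le ym /=.
  apply: leq_ltn_trans ym _.
  case/orP: xr => [/(allP tr)|]; first exact: ltn_trans.
  by rewrite !inE => /orP[]/eqP-> //; apply: ltn_trans tk.
by rewrite contains_glue_peak.
Qed.
End Glue.
End Pattern.

(** * Recurrences and functional equations *)

Lemma size_motzkin_avoiders n s :
  size (motzkin_avoiders n s) = count (avoids^~ s) (motzkin_perms n).
Proof. exact: size_filter. Qed.

Lemma size_motzkin_avoiders_rec n y s : has (ltn y) s ->
  size (motzkin_avoiders n.+1 (y :: s)) =
  size (motzkin_avoiders n (y :: s)) +
  \sum_(i < n) \sum_(a <- motzkin_perms i) \sum_(b <- motzkin_perms (n.-1 - i))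
     avoids (glue a b) (y :: s).
Proof.
move=> ys; rewrite !size_motzkin_avoiders count_motzkin_perms; congr (_ + _).
apply: eq_in_count => b /=; rewrite mem_motzkin_perms => /andP[pb _].
rewrite /avoids contains_cons //; apply/allP => x.
by rewrite (perm_mem pb) mem_iota add1n => /andP[].
Qed.

Lemma big_andb_count (S T : Type) (s : seq S) (t : seq T) (P : pred S) (Q : pred T) :
  \sum_(a <- s) \sum_(b <- t) (P a && Q b) = count P s * count Q t.
Proof.
rewrite -!sum1_count [in RHS]big_mkcond [X in _ * X]big_mkcond big_distrlr /=.
by apply: eq_bigr => a _; apply: eq_bigr => b _; case: (P a); case: (Q b).
Qed.

Local Open Scope ring_scope.

Lemma coef_fpsX_mul f n :
  coef_fps (fpsX * f) n = if n is m.+1 then coef_fps f m else 0.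
Proof.
case: n => [|n] /=; first by rewrite big_ord1 mul0r.
rewrite !big_ord_recl /= mul0r add0r mul1r subn1 /= big1 ?addr0 // => i _.
by rewrite mul0r.
Qed.

Lemma coef_fpsD f g n : coef_fps (f + g) n = coef_fps f n + coef_fps g n.
Proof. by []. Qed.

(** The case [n] = 0 has no [s] term because a glued word has at least two letters. *)
Lemma fps_eq_rec f s : coef_fps f 0 = 1 ->
  (forall n, coef_fps f n.+1 =
     coef_fps f n + (if n is m.+1 then coef_fps s m else 0)) ->
  f = 1 + fpsX * f + fpsX ^+ 2 * s.
Proof.
move=> f0 fS; rewrite expr2 -mulrA; apply: fpsP => -[|n].
  by rewrite !coef_fpsD !coef_fpsX_mul f0 /= !addr0.
by rewrite fS !coef_fpsD !coef_fpsX_mul /= add0r.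
Qed.

(** The constant coefficient is 1. Both denominators have this shape with [f] = 1, once a factor
    [fpsX] is taken out of the square. *)
Lemma fps_unit_subX f g : 1 - fpsX * f - fpsX * g \is a @GRing.unit fps.
Proof.
have e : coef_fps (1 - fpsX * f - fpsX * g) 0 = 1.
  rewrite !coef_fpsD.
  by rewrite -[coef_fps (- (fpsX * g)) 0]/(- coef_fps (fpsX * g) 0)
    -[coef_fps (- (fpsX * f)) 0]/(- coef_fps (fpsX * f) 0) !coef_fpsX_mul /= !subr0.
by rewrite -[_ \is a _]/(coef_fps _ 0 != 0) e oner_eq0.
Qed.

Lemma coef_N0 y s : coef_fps (N_ (y :: s)) 0 = 1.
Proof.
have av0 z u : avoids [::] (z :: u).
  by apply/containsP => -[v]; rewrite subseq0 => /eqP-> /order_isomorphic_size.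
have asc0 : has_motzkin_ascent [::] = false.
  by apply/negbTE/has_motzkin_ascentP => -[? [? []]].
rewrite /= size_motzkin_avoiders /motzkin_perms.
rewrite (_ : permutations (iota 1 0) = [:: [::]]) //=.
by rewrite /motzkin_perm av0 asc0 /= av0.
Qed.

Section GeneratingFunctions.
Variables (r th : seq nat) (t k m : nat).
Hypotheses (tr : all (ltn t) r) (kr : all (gtn k) r) (tk : (t < k)%N).
Hypotheses (th1 : all (ltn 1) th) (thm : all (gtn m) th) (m1 : (1 < m)%N) (mt : (m < t)%N).

Let psi := th ++ [:: 1%N; m].
Let tau := r ++ [:: t; k] ++ psi.

Lemma coef_N_rec y s : has (ltn y) s -> forall n,
   coef_fps (N_ (y :: s)) n.+1 = coef_fps (N_ (y :: s)) n +
  (\sum_(i < n) \sum_(a <- motzkin_perms i) \sum_(b <- motzkin_perms (n.-1 - i))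
     avoids (glue a b) (y :: s))%:R.
Proof. by move=> ys n; rewrite /= size_motzkin_avoiders_rec // natrD. Qed.

Lemma N_psi : N_ psi = 1 / (1 - fpsX - fpsX ^+ 2 * N_ th).
Proof.
have rec : N_ psi = 1 + fpsX * N_ psi + fpsX ^+ 2 * (N_ th * N_ psi).
  (* The recurrence needs a first entry that is not maximal: it is 1 or the first entry of [th], and
     [m] exceeds it. *)
  have [y [s [e ys]]] : exists y s, psi = y :: s /\ has (ltn y) s.
    rewrite /psi; case: th thm => [|y s] /=; first by exists 1%N, [:: m]; rewrite /= m1.
    by case/andP=> ym _; exists y, (s ++ [:: 1%N; m]); rewrite has_cat /= ym !orbT.
  apply: fps_eq_rec => [|n]; first by rewrite e coef_N0.
  rewrite e coef_N_rec // -e; congr (_ + _); case: n => [|n]; first by rewrite big_ord0.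
  rewrite natr_sum; apply: eq_bigr => i _ /=; rewrite -natrM !size_motzkin_avoiders.
  rewrite -big_andb_count; congr _%:R.
  apply: eq_big_seq => a /motzkin_permsP[_ pa].
  apply: eq_big_seq => b /motzkin_permsP[_ pb].
  by rewrite /avoids contains_glue_psi // negb_or.
have := fps_unit_subX 1 (fpsX * N_ th); rewrite mulr1 mulrA => u.
apply: (canRL (mulrK u)).
transitivity (N_ psi - fpsX * N_ psi - fpsX ^+ 2 * (N_ th * N_ psi)); first by ring.
by rewrite {1}rec; ring.
Qed.

Lemma N_tau : N_ tau = (1 - fpsX ^+ 2 * N_ r * N_ psi) / (1 - fpsX - fpsX ^+ 2 * (N_ r + N_ psi)).
Proof.
pose S := N_ r * N_ tau + N_ tau * N_ psi - N_ r * N_ psi.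
have rec : N_ tau = 1 + fpsX * N_ tau + fpsX ^+ 2 * S.
  have [y [s [e ys]]] : exists y s, tau = y :: s /\ has (ltn y) s.
    rewrite /tau; case: r kr => [|y s] /=; first by exists t, (k :: psi); rewrite /= tk.
    case/andP=> ym _; exists y, (s ++ [:: t, k & psi]); rewrite has_cat /= ym.
    by rewrite !orbT.
  apply: fps_eq_rec => [|n]; first by rewrite e coef_N0.
  rewrite e coef_N_rec // -e; congr (_ + _); case: n => [|n]; first by rewrite big_ord0.
  (* The subtracted product is moved to the other side, so that both sides become sums of natural
     numbers comparable pair by pair. *)
  apply: (addIr (coef_fps (N_ r * N_ psi) n)).
  rewrite -[in RHS]coef_fpsD subrK coef_fpsD /= natr_sum -!big_split /=.
  apply: eq_bigr => i _ /=; rewrite -!natrM -!natrD !size_motzkin_avoiders.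
  rewrite -!big_andb_count -!big_split /=; congr _%:R.
  apply: eq_big_seq => a /motzkin_permsP[_ pa]; rewrite -!big_split /=.
  apply: eq_big_seq => b /motzkin_permsP[_ pb].
  rewrite /avoids contains_glue_tau // !negb_or negb_and.
  (* Containing tau forces containing [r] and psi. With these two implications, inclusion-exclusion
     for a single pair [(a, b)] is a finite Boolean check. *)
  have := @contains_catr b (r ++ [:: t; k]) psi; rewrite -catA.
  have := @contains_catl a r ([:: t; k] ++ psi).
  rewrite -[r ++ _ ++ _]/tau -/psi.
  by move=> /implyP + /implyP; do 4!case: contains.
have := fps_unit_subX 1 (fpsX * (N_ r + N_ psi)); rewrite mulr1 mulrA => u.
apply: (canRL (mulrK u)).
transitivity (N_ tau - fpsX * N_ tau - fpsX ^+ 2 * (N_ r + N_ psi) * N_ tau); first by ring.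
by rewrite {1}rec /S; ring.
Qed.
End GeneratingFunctions.

(** * Passing to the reduced patterns *)

Lemma N_map f s : {in s &, {mono f : x y / (x < y)%N}} -> N_ (map f s) = N_ s.
Proof.
move=> fm; apply: fpsP => n /=; rewrite !size_motzkin_avoiders; congr _%:R.
by apply: eq_count => w; rewrite /avoids contains_mapr.
Qed.

Theorem theorem3p8 (k t : nat) (tau rho' theta' rho theta : seq nat) :
  tau = rho' ++ [:: t; k] ++ theta' ++ [:: 1%N; (t - 1)%N] ->
  tau \in motzkin_perms k ->
  (forall a, a \in rho' -> (t < a)%N) ->
  (forall b, b \in theta' -> (b < t)%N) ->
  rho = [seq (a - t)%N | a <- rho'] ->
  theta = [seq (b - 1)%N | b <- theta'] ->
  N_ tau =
    (1 - fpsX ^+ 2 * N_ rho * Ntilde theta)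
      / (1 - fpsX - fpsX ^+ 2 * (N_ rho + Ntilde theta)).
Proof.
move=> etau; rewrite mem_motzkin_perms => /andP[ptau _] rho_gt theta_lt -> ->.
have utau : uniq tau by rewrite (perm_uniq ptau) iota_uniq.
have tau_range x : x \in tau -> (0 < x <= k)%N.
  by rewrite (perm_mem ptau) mem_iota add1n ltnS.
move: utau tau_range; rewrite {ptau}etau => utau tau_range.
rewrite N_map => [|x y /rho_gt ? /rho_gt ?]; last by lia.
(* Truncated subtraction of 1 preserves strict order here because entries of tau are positive. *)
rewrite /Ntilde N_map => [|x y xt yt]; last first.
  have /andP[? _] : (0 < x <= k)%N by rewrite tau_range // !mem_cat xt !orbT.
  have /andP[? _] : (0 < y <= k)%N by rewrite tau_range // !mem_cat yt !orbT.
  lia.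
have range_t1 : (0 < t - 1 <= k)%N by rewrite tau_range // !mem_cat !inE eqxx !orbT.
have range_t : (0 < t <= k)%N by rewrite tau_range // !mem_cat !inE eqxx !orbT.
(* Distinctness of the entries of tau turns the weak range bounds into the strict inequalities
   needed: 1 < t - 1, t < k, rho' below k, and theta' strictly between 1 and t - 1. *)
move: utau; rewrite cat_uniq => /and3P[_ /hasPn rho_disj].
rewrite cat_uniq => /and3P[/=]; rewrite inE andbT => tk.
move=> /hasPn tk_disj; rewrite cat_uniq => /and3P[_ /hasPn th_disj /=].
rewrite inE andbT => one_t1.
have m1 : (1 < t - 1)%N by lia.
have lt_tk : (t < k)%N by lia.
have hr : all (gtn k) rho'.
  apply/allP => x xr /=; have /andP[_] : (0 < x <= k)%N by rewrite tau_range // mem_cat xr.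
  rewrite leq_eqVlt => /predU1P[ex|//].
  by have := rho_disj k; rewrite !inE eqxx orbT /= -{1}ex xr => /(_ isT).
have hth x : x \in theta' -> (1 < x < t - 1)%N.
  move=> xt; have /andP[x0 _] : (0 < x <= k)%N by rewrite tau_range // !mem_cat xt !orbT.
  have xlt := theta_lt _ xt.
  have x1 : x != 1%N by apply: contraL xt => /eqP->; apply: th_disj; rewrite !inE eqxx.
  have xt1 : x != (t - 1)%N.
    by apply: contraL xt => /eqP->; apply: th_disj; rewrite !inE eqxx orbT.
  lia.
have h1 : all (ltn 1) theta' by apply/allP => x /hth /andP[].
have hm : all (gtn (t - 1)%N) theta' by apply/allP => x /hth /andP[].
have mt : (t - 1 < t)%N by lia.
have htr : all (ltn t) rho' by apply/allP => x /rho_gt.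
by rewrite N_tau // N_psi.
Qed.
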